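(* Let $\mathbb{K}$ be a field of characteristic zero, let $\lambda_1,\dots,\lambda_k\in\mathbb{K}$ be $k$ distinct elements, let $m_1,\dots,m_k$ be positive integers, and put $n=\sum_{j=1}^k m_j$. For every choice of elements $c_j^{(m)}\in\mathbb{K}$ ($1\le j\le k$, $0\le m<m_j$), there exists a unique polynomial $L\in\mathbb{K}[x]$ of degree less than $n$ such that $L^{(m)}(\lambda_j)=c_j^{(m)}$ for all $1\le j\le k$ and $0\le m<m_j$. (That is, the Lagrange interpolation polynomial with given interpolation points, multiplicities and interpolation data exists and is unique.)
   Context: For a polynomial $L\in\mathbb{K}[x]$, $L^{(0)}=L$ and for $m>0$, $L^{(m)}$ is the $m$-th (formal) derivative of $L$. The zero polynomial is regarded as having degree less than $n$. A polynomial $L$ of degree less than $n$ with $L^{(m)}(\lambda_j)=c_j^{(m)}$ for all $1\le j\le k$, $0\le m<m_j$ is called the Lagrange interpolation polynomial with interpolation points $\lambda_1,\dots,\lambda_k$, multiplicities $m_1,\dots,m_k$ and interpolation data $c_j^{(m)}$. *)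

(* Defs.v *)
From mathcomp Require Export all_boot all_order all_algebra.

Set Implicit Arguments.
Unset Strict Implicit.
Unset Printing Implicit Defensive.

Import GRing.Theory.
Local Open Scope ring_scope.

(* [size L <= n] says that [L] has degree less than [n], the zero polynomial
   (of size 0) included.  The datum [c j i] is prescribed for the [i]-th formal
   derivative [L^`(i)] at [lam j], with [i < mult j]. *)
Definition lagrange_interpolation_poly (K : fieldType) (k : nat)
    (lam : 'I_k -> K) (mult : 'I_k -> nat)
    (c : forall j : 'I_k, 'I_(mult j) -> K) (L : {poly K}) : Prop :=
  (size L <= \sum_(j < k) mult j)%N /\
  forall (j : 'I_k) (i : 'I_(mult j)), L^`(i).[lam j] = c j i.

(* Main.v *)
Require Import Defs.
From mathcomp Require Import all_boot all_order all_algebra.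

Set Implicit Arguments.
Unset Strict Implicit.
Unset Printing Implicit Defensive.

Import GRing.Theory.
Local Open Scope ring_scope.

(** The [n] conditions on [L] are values of [n] linear functionals
    [L |-> L^`(i).[lam j]] on the [n]-dimensional space of polynomials of degree
    less than [n], so existence and uniqueness both follow once zero is the only
    such polynomial on which all the functionals vanish
    ([exists_poly_functionals] is the passage from a trivial common kernel to
    existence).

    Let [p] be a polynomial annihilated by all the functionals.  Since
    [i`! != 0] in characteristic zero, its Taylor expansion at [lam j] has no
    term of order less than [mult j], so [('X - (lam j)%:P) ^+ mult j] divides
    [p] ([dvdp_XsubC_exp_derivn]).  These powers are pairwise coprime, hence
    their product, of degree [n], divides [p] ([dvdp_prod_coprime]), and a [p] of
    degree less than [n] must be zero. *)

Lemma dvdp_prod_coprime (K : fieldType) (I : eqType) (r : seq I)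
    (q : I -> {poly K}) (p : {poly K}) :
    uniq r -> (forall i j, i != j -> coprimep (q i) (q j)) ->
    (forall i, q i %| p) ->
  \prod_(i <- r) q i %| p.
Proof.
move=> + q_co q_dvd; elim: r => [|i r IHr] /=.
  by rewrite big_nil dvd1p.
case/andP=> i_r r_uniq; rewrite big_cons Gauss_dvdp ?q_dvd ?IHr //.
rewrite big_seq; apply: (big_ind (coprimep (q i))).
- exact: coprimep1.
- by move=> x y cx cy; rewrite coprimepMr cx.
- by move=> j j_r; apply: q_co; apply: contraNneq i_r => ->.
Qed.

(** Taylor's formula at [a], read in [{poly K}] at the point
    ['X = a%:P + ('X - a%:P)]. *)
Lemma poly_taylor_XsubC (K : fieldType) (p : {poly K}) (a : K) :
  p = \sum_(i < size p) (p^`N(i).[a])%:P * ('X - a%:P) ^+ i.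
Proof.
rewrite -{1}[p]comp_polyXr /comp_poly -[X in _.[X]](addrNK a%:P) addrC.
rewrite nderiv_taylor; last exact: mulrC.
rewrite size_map_polyC; apply: eq_bigr => i _.
by rewrite nderivn_map horner_map.
Qed.

Lemma dvdp_XsubC_exp_derivn (K : fieldType) (p : {poly K}) (a : K) (m : nat) :
    [pchar K] =i pred0 -> (forall i, (i < m)%N -> p^`(i).[a] = 0) ->
  ('X - a%:P) ^+ m %| p.
Proof.
move=> /pcharf0P charK0 p_a; rewrite [p](poly_taylor_XsubC p a).
apply: (big_ind (fun s => ('X - a%:P) ^+ m %| s)) => [|x y|i _].
- exact: dvdp0.
- exact: dvdp_add.
have [i_lt_m | m_le_i] := ltnP i m; last by rewrite dvdp_mull // dvdp_exp2l.
have /eqP := p_a i i_lt_m.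
rewrite nderivn_def hornerMn -mulr_natr mulf_eq0 charK0 eqn0Ngt fact_gt0 orbF.
by move=> /eqP ->; rewrite mul0r dvdp0.
Qed.

(** In the monomial basis the functionals are the columns of a square matrix;
    it is invertible because its row kernel is trivial. *)
Lemma exists_poly_functionals (K : fieldType) (T : finType)
    (ell : T -> {scalar {poly K}}) (b : T -> K) :
    (forall p : {poly K}, (size p <= #|T|)%N -> (forall t, ell t p = 0) ->
      p = 0) ->
  exists2 p : {poly K}, (size p <= #|T|)%N & forall t, ell t p = b t.
Proof.
move=> ell_inj.
pose A := \matrix_(i < #|T|, s < #|T|) ell (enum_val s) ('X^i : {poly K}).
have AE (u : 'rV_#|T|) s : (u *m A) 0 s = ell (enum_val s) (rVpoly u).
  rewrite mxE /rVpoly poly_def linear_sum; apply: eq_bigr => i _.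
  by rewrite linearZ valK mxE.
have A_unit : A \in unitmx.
  rewrite -row_free_unit -kermx_eq0; apply/rowV0P => u /sub_kermxP uA0.
  apply: (can_inj rVpolyK); rewrite linear0; apply: ell_inj => [|t].
    exact: size_poly.
  by rewrite -[t]enum_rankK -AE uA0 mxE.
exists (rVpoly ((\row_s b (enum_val s)) *m invmx A)) => [|t].
  exact: size_poly.
by rewrite -[t]enum_rankK -AE mulmxKV // mxE.
Qed.

(** The degree count: a nonzero multiple of the product of the powers
    [('X - (lam j)%:P) ^+ mult j] has degree at least [\sum_(j < k) mult j]. *)
Lemma interpolation_kernel (K : fieldType) (k : nat) (lam : 'I_k -> K)
    (mult : 'I_k -> nat) (p : {poly K}) :
    [pchar K] =i pred0 -> injective lam ->
    (size p <= \sum_(j < k) mult j)%N ->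
    (forall j (i : 'I_(mult j)), p^`(i).[lam j] = 0) ->
  p = 0.
Proof.
move=> charK0 lam_inj p_small p_lam.
apply: contraTeq p_small => p_neq0; rewrite -ltnNge.
pose q j := ('X - (lam j)%:P) ^+ mult j.
have q_dvd : \prod_(j < k) q j %| p.
  apply: dvdp_prod_coprime => [|i j i_neq_j|j].
  - exact: index_enum_uniq.
  - apply/coprimep_expl/coprimep_expr.
    by rewrite coprimep_XsubC root_XsubC (inj_eq lam_inj) eq_sym.
  - apply: dvdp_XsubC_exp_derivn => // i i_lt.
    exact: (p_lam j (Ordinal i_lt)).
apply: leq_trans (dvdp_leq p_neq0 q_dvd); rewrite size_prod => [|j _]; last first.
  by rewrite expf_neq0 // polyXsubC_eq0.
have -> : (\sum_(j < k) size (q j) = \sum_(j < k) (mult j + 1))%N.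
  by apply: eq_bigr => j _; rewrite size_exp_XsubC addn1.
by rewrite big_split /= sum1_card -addSn addnK.
Qed.

Theorem theorem1p2 (K : fieldType) (charK0 : [pchar K] =i pred0)
    (k : nat) (lam : 'I_k -> K) (lam_inj : injective lam)
    (mult : 'I_k -> nat) (mult_gt0 : forall j : 'I_k, (0 < mult j)%N)
    (c : forall j : 'I_k, 'I_(mult j) -> K) :
  exists! L : {poly K}, lagrange_interpolation_poly lam c L.
Proof.
pose T : finType := {j : 'I_k & 'I_(mult j)}.
have cardT : #|T| = (\sum_(j < k) mult j)%N.
  rewrite card_tagged sumnE big_map big_enum /=.
  by apply: eq_bigr => j _; rewrite card_ord.
pose ell (t : T) : {scalar {poly K}} :=
  horner_eval (lam (tag t)) \o derivn (tagged t).
have [p|L L_size L_c] := @exists_poly_functionals K T ell (fun t => c _ (tagged t)).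
  rewrite cardT => p_size p_ell.
  apply: (interpolation_kernel charK0 lam_inj p_size) => j i.
  exact: (p_ell (Tagged _ i)).
have L_lam j (i : 'I_(mult j)) : L^`(i).[lam j] = c j i.
  exact: (L_c (Tagged _ i)).
rewrite cardT in L_size.
exists L; split=> // M [M_size M_lam].
apply/eqP; rewrite -subr_eq0; apply/eqP.
apply: (interpolation_kernel (mult := mult) charK0 lam_inj) => [|j i].
  apply: leq_trans (size_polyD _ _) _.
  by rewrite geq_max size_polyN M_size L_size.
by rewrite derivnB hornerD hornerN M_lam L_lam subrr.
Qed.
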